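(* Let $X_1,\dots,X_p$ be mutually independent real random variables with continuous distributions (the null hypothesis $H_0$), and let $\hat\xi_{kl}$ ($1\le k\ne l\le p$) be the Chatterjee rank correlation computed from $n$ i.i.d. copies of $(X_1,\dots,X_p)^\top$. Put $u_n=\mathrm{E}(\hat\xi_{kl}^2)$ and $v_n^2=\mathrm{Var}(\hat\xi_{kl}^2)$. Then $$u_n=\frac{(n-2)(4n-7)}{10(n-1)^2(n+1)},$$ $$v_n^2=\frac{224n^5-1792n^4+5051n^3-4969n^2-2458n+18128}{700(n-1)^4(n+1)^3}.$$
   Context: Let $\boldsymbol X_i=(X_{i1},\dots,X_{ip})^\top$, $i=1,\dots,n$, be i.i.d. copies of $\boldsymbol X=(X_1,\dots,X_p)^\top$. For $k\neq l$, rearrange the pairs $(X_{1k},X_{1l}),\dots,(X_{nk},X_{nl})$ as $(X_{(1)k},X^k_{[1]l}),\dots,(X_{(n)k},X^k_{[n]l})$ so that $X_{(1)k}\le\dots\le X_{(n)k}$, and let $R^k_{[i]l}=\sum_{j=1}^n I(X^k_{[j]l}\le X^k_{[i]l})$ be the rank of $X^k_{[i]l}$. The Chatterjee rank correlation is $$\hat\xi_{kl}=1-\frac{3\sum_{i=1}^{n-1}|R^k_{[i+1]l}-R^k_{[i]l}|}{n^2-1}.$$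
   Formalization: The formula for u_n is proved for all n ≥ 2 (the coefficient is undefined at n = 1) and the formula for v_n^2 only for n ≥ 4, since it is false for n = 2 (true value 0, formula 68/105) and n = 3 (true value 1/2048, formula 167/10240). *)

(* Defs.v *)
From mathcomp Require Import all_boot all_order all_algebra.
From mathcomp Require Import all_classical all_reals all_analysis.

Set Implicit Arguments.
Unset Strict Implicit.
Unset Printing Implicit Defensive.

Import Order.TTheory GRing.Theory Num.Theory.
Import numFieldNormedType.Exports.

Local Open Scope classical_set_scope.
Local Open Scope ring_scope.

Definition mutually_independent (d d' : measure_display) (T : measurableType d)
    (T' : measurableType d') (R : realType) (P : probability T R)
    (I : finType) (X : I -> T -> T') : Prop :=
  forall (J : {set I}) (B : I -> set T'),
    (forall i, i \in J -> measurable (B i)) ->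
    P (\bigcap_(i in [set` J]) X i @^-1` B i) =
    (\prod_(i in J) P (X i @^-1` B i))%E.

Definition identically_distributed (d d' : measure_display)
    (T : measurableType d) (T' : measurableType d') (R : realType)
    (P : probability T R) (X Y : T -> T') : Prop :=
  forall B : set T', measurable B -> P (X @^-1` B) = P (Y @^-1` B).

Definition random_vector (T R : Type) (p : nat) (X : 'I_p -> T -> R) (w : T) :
    p.-tuple R := [tuple X k w | k < p].

Definition iid_copies (d : measure_display) (T : measurableType d)
    (R : realType) (P : probability T R) (n p : nat)
    (Xs : 'I_n -> 'I_p -> T -> R) (X : 'I_p -> T -> R) : Prop :=
  mutually_independent P (fun i => random_vector (Xs i)) /\
  forall i, identically_distributed P (random_vector (Xs i)) (random_vector X).

(* Equal [x]-values keep their original relative order, as [sort] is stable. *)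
Definition rearranged_pairs (R : realType) (n : nat) (x y : 'I_n -> R) :
    seq (R * R) :=
  sort (fun a b => a.1 <= b.1) [seq (x i, y i) | i <- enum 'I_n].

(* Positions are numbered from 0. *)
Definition concomitant (R : realType) (n : nat) (x y : 'I_n -> R) (i : nat) :
    R := (nth (0, 0) (rearranged_pairs x y) i).2.

Definition concomitant_rank (R : realType) (n : nat) (x y : 'I_n -> R)
    (i : nat) : nat :=
  (\sum_(j < n) (concomitant x y j <= concomitant x y i)%R)%N.

Definition chatterjee (R : realType) (n : nat) (x y : 'I_n -> R) : R :=
  1 - 3 * (\sum_(0 <= i < n.-1)
             `|(concomitant_rank x y i.+1)%:R - (concomitant_rank x y i)%:R|)
      / (n%:R ^+ 2 - 1).

(* Main.v *)
(** The coefficient is a function of the permutation s that lists the ranks of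
    the second sample in the order of the first one: it is determined by
    S = \sum_i |s (i+1) - s i|.  Without ties (a null event, the distributions
    having no atoms) all pairs of orderings of the two samples have the same
    probability, as the joint law of the samples is invariant under permuting
    each of them, so s is uniform and the theorem is about the first four
    moments of S for a uniform permutation.

    Build a permutation of 0, ..., n - 1 by inserting the values in increasing
    order.  Give the gap between neighbours a and b the age n - max(a, b), and
    the two ends the ages y = n - a and z = n - b of the end values.  Inserting
    n into a gap replaces it by two gaps of age 1 and increases every other age
    by 1, so the position of a gap plays no role, and
    S = n (n + 1) - y - z - 2 p_1 where p_k is the sum of the k-th powers of the
    ages of the gaps.  Averaging over the place of insertion expresses the mean
    at n + 1 of a monomial in y, z, p_1, ..., p_4 by means at n of monomials of
    at most the same weight, where p_k has weight k.  Hence polynomials in n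
    that satisfy this finite system of recurrences and are right at n = 4 give
    all the moments of weight at most 4; such polynomials are found by
    interpolation, and the recurrences are checked by computation. *)

From Stdlib Require Import ZArith Lia.
From HB Require Import structures.
Require Import Defs.
From mathcomp Require Import all_boot all_order all_algebra all_fingroup.
From mathcomp Require Import zify ssrZ.
From mathcomp Require Import all_classical all_reals all_analysis.
From mathcomp Require Import measurable_realfun.

Set Implicit Arguments.
Unset Strict Implicit.
Unset Printing Implicit Defensive.

Import Order.TTheory GRing.Theory Num.Theory.
Import numFieldNormedType.Exports.

(** * Moments of the jumps of a uniform permutation *)

Section Jumps.
Local Open Scope Z_scope.
Local Arguments Z.mul : simpl never.
Local Arguments Z.add : simpl never.

Definition zsum (T : Type) (f : T -> Z) (s : seq T) : Z :=
  foldr (fun x a => f x + a) 0 s.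

Lemma zsum_cat T (f : T -> Z) s t : zsum f (s ++ t) = zsum f s + zsum f t.
Proof. by elim: s => //= x s ->; rewrite Z.add_assoc. Qed.

Lemma eq_zsum T (f g : T -> Z) s : f =1 g -> zsum f s = zsum g s.
Proof. by move=> fg; elim: s => //= x s ->; rewrite fg. Qed.

Lemma eq_in_zsum (T : eqType) (f g : T -> Z) s :
  {in s, f =1 g} -> zsum f s = zsum g s.
Proof.
elim: s => //= x s IHs fg.
by rewrite fg ?mem_head // IHs // => y ys; apply: fg; rewrite inE ys orbT.
Qed.

Lemma zsum_map T U (h : U -> T) (f : T -> Z) s :
  zsum f (map h s) = zsum (f \o h) s.
Proof. by elim: s => //= x s ->. Qed.

Lemma zsum_flatten T (f : T -> Z) ss :
  zsum f (flatten ss) = zsum (zsum f) ss.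
Proof. by elim: ss => //= s ss <-; rewrite zsum_cat. Qed.

Lemma zsumD T (f g : T -> Z) s :
  zsum (fun x => f x + g x) s = zsum f s + zsum g s.
Proof. by elim: s => //= x s ->; lia. Qed.

Lemma zsumMl T c (f : T -> Z) s : zsum (fun x => c * f x) s = c * zsum f s.
Proof. by elim: s => [|x s IHs] /=; lia. Qed.

Lemma exchange_zsum T U (f : T -> U -> Z) s t :
  zsum (fun x => zsum (f x) t) s = zsum (fun y => zsum (f^~ y) s) t.
Proof.
elim: s => [|x s IHs] /=; first by elim: t => //= y t <-.
by rewrite IHs -zsumD.
Qed.

(** * Polynomials in finitely many statistics, as sums of weighted words *)

Definition zpow (x : Z) (k : nat) : Z := iter k (Z.mul x) 1.

(* A word [i1; ...; ir] over the variables stands for the monomial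
   [v i1 * ... * v ir]. *)
Definition weval (v : nat -> Z) (w : seq nat) : Z :=
  foldr (fun i a => v i * a) 1 w.

Definition wpoly := seq (Z * seq nat).

Definition peval (v : nat -> Z) (p : wpoly) : Z :=
  zsum (fun t => t.1 * weval v t.2) p.

Definition pmul (p q : wpoly) : wpoly :=
  [seq (t.1 * u.1, t.2 ++ u.2) | t <- p, u <- q].

Definition psubst (sigma : nat -> wpoly) (w : seq nat) : wpoly :=
  foldr (fun i p => pmul (sigma i) p) [:: (1, [::])] w.

Definition popp (p : wpoly) : wpoly := [seq (- t.1, t.2) | t <- p].

Lemma weval_cat v w1 w2 : weval v (w1 ++ w2) = weval v w1 * weval v w2.
Proof. by elim: w1 => [|i w1 IHw]; rewrite ?Z.mul_1_l //= IHw; ring. Qed.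

Lemma eq_weval v1 v2 w : v1 =1 v2 -> weval v1 w = weval v2 w.
Proof. by move=> vv; elim: w => //= i w ->; rewrite vv. Qed.

Lemma weval_perm v w1 w2 : perm_eq w1 w2 -> weval v w1 = weval v w2.
Proof.
elim: w1 w2 => [|i w1 IHw] w2; first by move/perm_size/esym/size0nil->.
move=> pw; have: i \in w2 by rewrite -(perm_mem pw) mem_head.
move=> /path.splitPr sp; case: sp pw => a b pw.
rewrite weval_cat /= (IHw (a ++ b)) ?weval_cat; first ring.
by rewrite -(perm_cons i) (perm_trans pw) // perm_sym -cat1s perm_catCA.
Qed.

Lemma weval_filter v (a : pred nat) w :
  weval v w = weval v (seq.filter a w) * weval v (seq.filter (predC a) w).
Proof.
by rewrite -weval_cat; apply/weval_perm; rewrite perm_sym perm_filterC.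
Qed.

Lemma weval_const c i v w : {in w, forall j, j = i} -> v i = c ->
  weval v w = zpow c (size w).
Proof.
move=> wi vi; elim: w wi => //= j w IHw wi.
rewrite (wi j) ?mem_head // vi IHw // => k kw.
by apply: wi; rewrite inE kw orbT.
Qed.

(** Used for variable [0], to sum over the selected gap, and for variable [3], whose value is
    known. *)
Lemma weval_split v i w :
  weval v w = zpow (v i) (count_mem i w) * weval v (seq.filter (predC1 i) w).
Proof.
rewrite (weval_filter v (pred1 i)) -size_filter; congr (_ * _).
by apply: (@weval_const _ i) => // j; rewrite mem_filter => /andP[/eqP].
Qed.

Lemma peval_cat v p q : peval v (p ++ q) = peval v p + peval v q.
Proof. exact: zsum_cat. Qed.

Lemma peval_opp v p : peval v (popp p) = - peval v p.
Proof. by rewrite /peval; elim: p => //= t p ->; lia. Qed.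

Lemma peval_mul v p q : peval v (pmul p q) = peval v p * peval v q.
Proof.
rewrite /peval /pmul zsum_flatten zsum_map; elim: p => //= t p ->.
rewrite Z.mul_add_distr_r; congr (_ + _); rewrite zsum_map.
rewrite -Z.mul_assoc -zsumMl -zsumMl.
by elim: q => //= u q ->; rewrite weval_cat; ring.
Qed.

Lemma peval_subst v sigma w :
  peval v (psubst sigma w) = weval (fun i => peval v (sigma i)) w.
Proof. by elim: w => //= i w IHw; rewrite peval_mul IHw. Qed.

(** * Ages of the gaps and insertion of a new maximum *)

Definition powsum (k : nat) (g : seq Z) : Z := zsum (zpow^~ k) g.

(* Variables: [0] is the age of a selected gap, [1] and [2] are the ages of the
   two ends, and [k.+3] is the [k]-th power sum of the ages of the gaps. *)
Definition select (x : Z) (v : nat -> Z) (i : nat) : Z :=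
  if i == 0%N then x else v i.

(** Summing [x ^ c] over the ages [x] of all gaps gives the power sum of exponent [c], so the [c]
    occurrences of variable [0] merge into the single variable [c.+3]. *)
Definition sum_selected (p : wpoly) : wpoly :=
  [seq (t.1, (count_mem 0%N t.2).+3 :: seq.filter (predC1 0%N) t.2) | t <- p].

Lemma peval_sum_selected v g p : (forall k, v k.+3 = powsum k g) ->
  peval v (sum_selected p) = zsum (fun x => peval (select x v) p) g.
Proof.
move=> vg; rewrite /peval exchange_zsum zsum_map; elim: p => //= t p ->.
congr (_ + _); rewrite zsumMl vg; congr (_ * _).
transitivity (zsum (fun x => weval v [seq x <- t.2 | predC1 0%N x] *
    zpow x (count_mem 0%N t.2)) g); first by rewrite zsumMl; apply: Z.mul_comm.
apply: eq_zsum => x; rewrite (weval_split _ 0%N t.2) Z.mul_comm /=.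
congr (_ * _); elim: t.2 => //= i w IHw.
rewrite -/(weval _ _); case: eqVneq => //= i0.
by rewrite {1}/select (negPf i0) IHw.
Qed.

Fixpoint gaps (n : nat) (a : nat) (s : seq nat) : seq Z :=
  if s is b :: s' then (Z.of_nat n - Z.of_nat (maxn a b)) :: gaps n b s'
  else [::].

Definition stat (n : nat) (s : seq nat) (i : nat) : Z :=
  match i with
  | 0%N => 0
  | 1%N => Z.of_nat n - Z.of_nat (head 0%N s)
  | 2%N => Z.of_nat n - Z.of_nat (last 0%N s)
  | k.+3 => powsum k (gaps n (head 0%N s) (behead s))
  end.

Definition insert_at (n : nat) (s : seq nat) (i : nat) : seq nat :=
  take i s ++ n :: drop i s.

Fixpoint perms (n : nat) : seq (seq nat) :=
  if n is m.+1 then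
    [seq insert_at m s i | s <- perms m, i <- iota 0 n]
  else [:: [::]].

Lemma permsS n :
  perms n.+1 = [seq insert_at n s i | s <- perms n, i <- iota 0 n.+1].
Proof. by []. Qed.

(** The expansion of [(x + 1) ^ k], where [x] is the age of the selected gap. *)
Definition succ_pow (k : nat) : wpoly :=
  psubst (fun _ => [:: (1, [:: 0%N]); (1, [::])]) (nseq k 0%N).

Definition aged_powsum (k : nat) : wpoly := sum_selected (succ_pow k).

(** A maximum placed at the front has age 1 and creates one gap of age 1; all other ages grow by 1.
    Variable [0] goes to the zero polynomial, in agreement with its placeholder value in [stat]. *)
Definition insert_first (i : nat) : wpoly :=
  match i with
  | 0%N => [::]
  | 1%N => [:: (1, [::])]
  | 2%N => [:: (1, [:: 2%N]); (1, [::])]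
  | k.+3 => aged_powsum k ++ [:: (1, [::])]
  end.

Definition insert_last (i : nat) : wpoly :=
  match i with
  | 0%N => [::]
  | 1%N => [:: (1, [:: 1%N]); (1, [::])]
  | 2%N => [:: (1, [::])]
  | k.+3 => aged_powsum k ++ [:: (1, [::])]
  end.

(* The selected gap, of age [x], is replaced by two gaps that have age 1 after
   the insertion. *)
Definition insert_gap (i : nat) : wpoly :=
  match i with
  | 0%N => [::]
  | 1%N => [:: (1, [:: 1%N]); (1, [::])]
  | 2%N => [:: (1, [:: 2%N]); (1, [::])]
  | k.+3 => aged_powsum k ++ popp (succ_pow k) ++ [:: (2, [::])]
  end.

Definition step (w : seq nat) : wpoly :=
  psubst insert_first w ++ psubst insert_last w ++
  sum_selected (psubst insert_gap w).

Lemma zpow1 k : zpow 1 k = 1.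
Proof. by elim: k => //= k; rewrite /zpow /= => ->. Qed.

Lemma weval_nseq v i k : weval v (nseq k i) = zpow (v i) k.
Proof. by elim: k => //= k ->. Qed.

Lemma peval_succ_pow v k : peval v (succ_pow k) = zpow (v 0%N + 1) k.
Proof.
rewrite peval_subst weval_nseq; congr (zpow _ _).
by rewrite /peval /=; lia.
Qed.

Lemma powsum_map (h : Z -> Z) k (g : seq Z) :
  powsum k (map h g) = zsum (fun x => zpow (h x) k) g.
Proof. exact: zsum_map. Qed.

Lemma peval_aged_powsum v g k : (forall k, v k.+3 = powsum k g) ->
  peval v (aged_powsum k) = powsum k (map (Z.add 1) g).
Proof.
move=> vg; rewrite (peval_sum_selected _ vg) powsum_map.
by apply: eq_zsum => x; rewrite peval_succ_pow /select /= Z.add_comm.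
Qed.

Lemma gaps_succ n a s : gaps n.+1 a s = map (Z.add 1) (gaps n a s).
Proof. by elim: s a => //= b s IHs a; rewrite IHs; congr (_ :: _); lia. Qed.

Lemma size_gaps n a s : size (gaps n a s) = size s.
Proof. by elim: s a => //= b s IHs a; rewrite IHs. Qed.

Lemma gaps_rcons n a s b :
  gaps n a (rcons s b) =
  rcons (gaps n a s) (Z.of_nat n - Z.of_nat (maxn (last a s) b)).
Proof. by elim: s a => //= c s IHs a; rewrite IHs. Qed.

Lemma maxn_below n a : (a < n)%N -> maxn a n = n /\ maxn n a = n.
Proof. by move=> an; split; [apply/maxn_idPr|apply/maxn_idPl]; apply: ltnW. Qed.

Lemma powsum_rcons k g x : powsum k (rcons g x) = powsum k g + zpow x k.
Proof. by rewrite /powsum -cats1 zsum_cat /=; lia. Qed.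

(** The gap that is split no longer contributes its aged term [(x + 1) ^ k]. The value [n] is the
    larger end of both new gaps, which thus have age 1 and contribute 2 in all. *)
Lemma powsum_gaps_insert n a s k i : (a < n)%N -> all (ltn^~ n) s ->
  (i < size s)%N ->
  powsum k (gaps n.+1 a (insert_at n s i)) =
  powsum k (map (Z.add 1) (gaps n a s)) - zpow (nth 0 (gaps n a s) i + 1) k + 2.
Proof.
elim: s a i => //= b s IHs a i an /andP[bn sn].
have one : Z.of_nat n.+1 - Z.of_nat n = 1 by lia.
have [[ea _] [_ eb]] := (maxn_below an, maxn_below bn).
case: i => [|i] /= is_; rewrite /powsum /=.
  rewrite ea eb one zpow1 gaps_succ -/(powsum _ _).
  by rewrite -/(powsum _ _) (Z.add_comm _ 1); lia.
rewrite -!/(powsum _ _) IHs // -Z.add_sub_assoc.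
have -> : Z.of_nat n.+1 - Z.of_nat (maxn a b) =
          1 + (Z.of_nat n - Z.of_nat (maxn a b)) by lia.
lia.
Qed.

Lemma weval_stat_first n a s w : (a < n)%N ->
  weval (stat n.+1 (n :: a :: s)) w =
  peval (stat n (a :: s)) (psubst insert_first w).
Proof.
move=> an; rewrite peval_subst; apply: eq_weval => -[|[|[|k]]] //=.
- by rewrite /peval /=; lia.
- by rewrite /peval /=; lia.
rewrite peval_cat (@peval_aged_powsum _ (gaps n a s)) // -gaps_succ.
have [_ ->] := maxn_below an; rewrite /powsum /peval /=.
have -> : Z.of_nat n.+1 - Z.of_nat n = 1 by lia.
by rewrite zpow1; lia.
Qed.

Lemma weval_stat_last n a s w : (last a s < n)%N ->
  weval (stat n.+1 (a :: rcons s n)) w =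
  peval (stat n (a :: s)) (psubst insert_last w).
Proof.
move=> an; rewrite peval_subst; apply: eq_weval => -[|[|[|k]]] //=.
- by rewrite /peval /=; lia.
- by rewrite last_rcons /peval /=; lia.
rewrite peval_cat (@peval_aged_powsum _ (gaps n a s)) // -gaps_succ.
rewrite gaps_rcons powsum_rcons; have [-> _] := maxn_below an.
have -> : Z.of_nat n.+1 - Z.of_nat n = 1 by lia.
by rewrite zpow1 /peval /=; lia.
Qed.

Lemma last_insert_at n a s i : (i < size s)%N ->
  last a (insert_at n s i) = last a s.
Proof.
move=> i_s; rewrite -{2}(cat_take_drop i s) /insert_at !last_cat /=.
case: (drop i s) (size_drop i s) => //= /esym /eqP.
by rewrite subn_eq0 leqNgt i_s.
Qed.

Lemma weval_stat_gap n a s i w : all (ltn^~ n) (a :: s) -> (i < size s)%N ->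
  weval (stat n.+1 (a :: insert_at n s i)) w =
  peval (select (nth 0 (gaps n a s) i) (stat n (a :: s))) (psubst insert_gap w).
Proof.
move=> /= /andP[an sn] i_s; rewrite peval_subst.
apply: eq_weval => -[|[|[|k]]] //=.
- by rewrite /peval /select /=; lia.
- by rewrite last_insert_at // /peval /select /=; lia.
rewrite powsum_gaps_insert // !peval_cat peval_opp peval_succ_pow.
rewrite (@peval_aged_powsum _ (gaps n a s)) // /peval /select /=; lia.
Qed.

Lemma zsum_nth (F : Z -> Z) g :
  zsum (fun i => F (nth 0 g i)) (iota 0 (size g)) = zsum F g.
Proof. by rewrite -{3}(mkseq_nth 0 g) /mkseq zsum_map. Qed.

Lemma zsum_insert n s w : (0 < size s)%N -> all (ltn^~ n) s ->
  zsum (fun i => weval (stat n.+1 (insert_at n s i)) w) (iota 0 (size s).+1) =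
  peval (stat n s) (step w).
Proof.
case: s => // a s _ sn; have [an _] := andP sn.

(* The places are the front, one inside each gap, and the back; behind the head [a], place [i.+1] is
   gap number [i]. *)
have -> : iota 0 (size (a :: s)).+1 =
          0%N :: map S (iota 0 (size s)) ++ [:: (size s).+1].
  by rewrite -(addn1 (size (a :: s))) iotaD /= (iotaDl 1 0).
rewrite /step !peval_cat /= zsum_cat zsum_map /= weval_stat_first //.
rewrite [insert_at _ _ _.+1]/insert_at /= take_size drop_size cats1.
rewrite weval_stat_last; last by apply: (allP sn); apply: mem_last.
rewrite (@peval_sum_selected _ (gaps n a s)) // -zsum_nth size_gaps.
rewrite (@eq_in_zsum _ _ (fun i => peval
  (select (nth 0 (gaps n a s) i) (stat n (a :: s))) (psubst insert_gap w))).
  by rewrite Z.add_0_r; congr (_ + _); apply: Z.add_comm.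
by move=> i; rewrite mem_iota /= add0n => i_s; rewrite -weval_stat_gap.
Qed.

(** * Enumeration of the permutations by insertion *)

Lemma perm_insert_at n s i : perm_eq (insert_at n s i) (n :: s).
Proof.
by rewrite /insert_at -cat1s perm_catCA /= cat_take_drop.
Qed.

Lemma perm_iotaS n s : perm_eq s (iota 0 n) ->
  perm_eq (n :: s) (iota 0 n.+1).
Proof.
move=> ps; rewrite -(addn1 n) iotaD cats1 perm_sym perm_rcons perm_cons.
by rewrite perm_sym.
Qed.

Lemma mem_perms n s : (s \in perms n) = perm_eq s (iota 0 n).
Proof.
elim: n s => [|n IHn] s.
  by rewrite inE; apply/eqP/idP => [->|/perm_nilP ->].
apply/allpairsPdep/idP => [[t [i [tn _ ->]]]|ps].
  by rewrite (perm_trans (perm_insert_at _ _ _)) // perm_iotaS // -IHn.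
have : n \in s by rewrite (perm_mem ps) mem_iota /=.
move=> /path.splitPr sp; case: sp ps => a b ps.
exists (a ++ b), (size a); rewrite IHn; split.
- rewrite -(perm_cons n); apply: perm_trans (_ : perm_eq _ (iota 0 n.+1)) _.
    by rewrite -cat1s perm_catCA.
  by rewrite perm_sym perm_iotaS.
- have := perm_size ps.
  rewrite size_cat size_iota [size (_ :: _)]/= addnS => -[<-].
  by rewrite mem_iota /= add0n ltnS leq_addr.
by rewrite /insert_at take_size_cat // drop_size_cat.
Qed.

Lemma perms_size n s : s \in perms n -> size s = n.
Proof. by rewrite mem_perms => /perm_size ->; rewrite size_iota. Qed.

Lemma perms_lt n s : s \in perms n -> all (ltn^~ n) s.
Proof.
rewrite mem_perms => /perm_all ->; apply/allP => i.
by rewrite mem_iota.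
Qed.

(** The position of [n] and the word left after deleting [n] recover the place of insertion and the
    shorter permutation. *)
Lemma uniq_perms n : uniq (perms n).
Proof.
elim: n => // n IHn; apply: allpairs_uniq_dep => //.
  by move=> s _; apply: iota_uniq.
move=> [s i] [t j] /allpairsPdep[s' [i' [sn ni [-> ->]]]].
move=> /allpairsPdep[t' [j' [tn nj [-> ->]]]] /= {s t i j}.
have notin u : u \in perms n -> n \notin u.
  by move=> /perms_lt /allP un; apply/negP => /un /=; rewrite ltnn.
have idx u k : u \in perms n -> k \in iota 0 n.+1 ->
    index n (insert_at n u k) = k /\
    seq.filter (predC1 n) (insert_at n u k) = u.
  move=> un; rewrite mem_iota add0n ltnS => /= kn.
  have nu := notin _ un; rewrite /insert_at index_cat filter_cat /= eqxx.
  have -> : (n \in take k u) = false.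
    by apply/negbTE; apply: contra nu; apply: mem_take.
  rewrite addn0 size_takel ?(perms_size un) // -filter_cat cat_take_drop.
  by split=> //; apply/all_filterP/allP => x xu /=; apply: contraNneq nu => <-.
move=> eq_st; have [i1 f1] := idx _ _ sn ni; have [i2 f2] := idx _ _ tn nj.
by move: i1 f1; rewrite eq_st i2 f2 => -> ->.
Qed.

Lemma size_perms n : size (perms n) = (n`!)%N.
Proof.
elim: n => // n IHn; rewrite factS -IHn mulnC permsS size_allpairs_dep.
by elim: (perms n) => // s l IHl; rewrite mulSn -IHl -{2}(size_iota 0 n.+1).
Qed.

(** * Dense polynomials in the sample size *)

(* A list of coefficients is the dense polynomial in [X] with the constant term
   first. *)
Definition deval (q : seq Z) (x : Z) : Z := foldr (fun c a => c + x * a) 0 q.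

Fixpoint dadd (p q : seq Z) : seq Z :=
  match p, q with
  | [::], _ => q
  | _, [::] => p
  | a :: p', b :: q' => a + b :: dadd p' q'
  end.

Definition dscale (c : Z) (q : seq Z) : seq Z := map (Z.mul c) q.

(* Multiplication by [X + a]. *)
Definition dlin (a : Z) (q : seq Z) : seq Z := dadd (dscale a q) (0 :: q).

(* Substitution of [X + 1] for [X]. *)
Definition dshift (q : seq Z) : seq Z :=
  foldr (fun c p => dadd [:: c] (dlin 1 p)) [::] q.

Definition dnull (q : seq Z) : bool := all (Z.eqb 0) q.

Lemma deval_add p q x : deval (dadd p q) x = deval p x + deval q x.
Proof.
elim: p q => // a p IHp [|b q] /=; first by rewrite Z.add_0_r.
by rewrite IHp; ring.
Qed.

Lemma deval_scale c q x : deval (dscale c q) x = c * deval q x.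
Proof. by elim: q => [|a q IHq] /=; rewrite ?IHq; ring. Qed.

Lemma deval_lin a q x : deval (dlin a q) x = (x + a) * deval q x.
Proof. by rewrite deval_add deval_scale /=; ring. Qed.

Lemma deval_shift q x : deval (dshift q) x = deval q (x + 1).
Proof.
elim: q => // a q IHq.
rewrite -[dshift _]/(dadd [:: a] (dlin 1 (dshift q))).
rewrite deval_add deval_lin IHq /=.
by rewrite Z.mul_0_r Z.add_0_r.
Qed.

Lemma dnullP q x : dnull q -> deval q x = 0.
Proof.
elim: q => //= c q IHq /andP[c0 q0]; have <- : 0 = c by apply/Z.eqb_eq.
by rewrite IHq //; ring.
Qed.

(** * Tables of moments closed under the recurrence *)

Definition table := seq (seq nat * seq Z).

Definition lookup (T : table) (w : seq nat) : seq Z :=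
  (nth ([::], [::]) T (index w (map fst T))).2.

(** Sorting gives one key per commutative monomial; the factors [p_0], equal to [n - 1], are moved
    into the coefficient. *)
Definition reduced (w : seq nat) : seq nat :=
  sort leq (seq.filter (predC1 3%N) w).

(* Variable [3] is the number [n - 1] of gaps, hence the factors [X - 1]. *)
Definition moment (T : table) (p : wpoly) : seq Z :=
  foldr (fun t a => dadd (dscale t.1
    (iter (count_mem 3%N t.2) (dlin (-1)) (lookup T (reduced t.2)))) a) [::] p.

Definition covers (T : table) (p : wpoly) : bool :=
  all (fun t => reduced t.2 \in map fst T) p.

(** As [(n + 1)! = n! (n + 1)], the recurrence for the entry [q] of [w] is the polynomial identity
    [moment T (step w) = (X + 1) q(X + 1)]. *)
Definition closed_table (T : table) : bool :=
  all (fun w => covers T (step w) &&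
    dnull (dadd (moment T (step w))
                (dscale (-1) (dlin 1 (dshift (lookup T w))))))
    (map fst T).

Definition total (n : nat) (p : wpoly) : Z :=
  zsum (fun s => peval (stat n s) p) (perms n).

(** The mean over the [n!] permutations is [q(n) / D]; the common denominator [D] keeps the
    arithmetic in [Z]. *)
Definition moments_at (n : nat) (D : Z) (T : table) : Prop :=
  {in map fst T, forall w, D * total n [:: (1, w)] =
    Z.of_nat n`! * deval (lookup T w) (Z.of_nat n)}.

Lemma stat_p0 n s : (0 < n)%N -> s \in perms n -> stat n s 3 = Z.of_nat n - 1.
Proof.
move=> n0 sn; rewrite /= /powsum.
have: size (gaps n (head 0%N s) (behead s)) = n.-1.
  by rewrite size_gaps size_behead (perms_size sn).
have zs g : zsum (zpow^~ 0%N) g = Z.of_nat (size g).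
  by elim: g => //= x g ->; rewrite /zpow /=; lia.
by rewrite zs => ->; case: n n0 {sn} => // m _; rewrite /=; lia.
Qed.

Lemma total_moment n D T p : (0 < n)%N -> moments_at n D T -> covers T p ->
  D * total n p = Z.of_nat n`! * deval (moment T p) (Z.of_nat n).
Proof.
move=> n0 Tn; rewrite /total exchange_zsum.
elim: p => [|[c w] p IHp] /=; first by move=> _; ring.
case/andP=> wT /IHp {}IHp; rewrite Z.mul_add_distr_l IHp deval_add.
rewrite deval_scale Z.mul_add_distr_l; congr (_ + _).
have -> : zsum (fun s => c * weval (stat n s) w) (perms n) =
    c * zpow (Z.of_nat n - 1) (count_mem 3%N w) * total n [:: (1, reduced w)].
  rewrite /total -zsumMl; apply: eq_in_zsum => s sn.
  rewrite (weval_split _ 3%N w) stat_p0 // /peval /= /reduced.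
  rewrite (@weval_perm _ (sort leq _) [seq x <- w | predC1 3%N x]);
    last by rewrite perm_sort.
  by rewrite Z.mul_1_l Z.add_0_r; apply: Z.mul_assoc.
have -> : deval (iter (count_mem 3%N w) (dlin (-1)) (lookup T (reduced w)))
   (Z.of_nat n) = zpow (Z.of_nat n - 1) (count_mem 3%N w) *
                  deval (lookup T (reduced w)) (Z.of_nat n).
  elim: (count_mem 3%N w) => [|j IHj] /=; first by rewrite Z.mul_1_l.
  by rewrite deval_lin IHj; ring.
have := Tn _ wT; set A := total _ _; set B := deval _ _; set C := zpow _ _.
move=> AB; transitivity (c * C * (D * A)); first by ring.
by rewrite AB; ring.
Qed.

Lemma total_perms_succ n w : (0 < n)%N ->
  total n.+1 [:: (1, w)] = total n (step w).
Proof.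
move=> n0; rewrite /total permsS zsum_flatten zsum_map.
apply: eq_in_zsum => s sn; have s_n := perms_size sn.
rewrite -zsum_insert ?perms_lt ?s_n //; apply: etrans (zsum_map _ _ _) _.
by apply: eq_zsum => i; rewrite /peval /=; ring.
Qed.

Lemma moments_at_succ n D T : (0 < n)%N -> closed_table T ->
  moments_at n D T -> moments_at n.+1 D T.
Proof.
move=> n0 /allP cT Tn w wT; have /andP[cw /(@dnullP _ (Z.of_nat n))] := cT _ wT.
rewrite deval_add deval_scale deval_lin deval_shift total_perms_succ //.
rewrite (total_moment n0 Tn cw) factS Nat2Z.inj_mul Nat2Z.inj_succ.
set a := deval _ _; set b := deval _ _ => ab.
have -> : a = (Z.of_nat n + 1) * b by lia.
by rewrite /Z.succ; ring.
Qed.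

Lemma moments_from n0 n D T : (0 < n0)%N -> closed_table T ->
  moments_at n0 D T -> (n0 <= n)%N -> moments_at n D T.
Proof.
move=> n0_gt0 cT T0 /subnKC <-; elim: (n - n0)%N => [|j IHj].
  by rewrite addn0.
by rewrite addnS; apply: moments_at_succ; rewrite ?addn_gt0 ?n0_gt0.
Qed.

(** * The sum of the jumps as a polynomial in the statistics *)

(** Subtraction is truncated, so one of the two differences vanishes and their sum is the
    distance. *)
Fixpoint jumps_from (a : nat) (s : seq nat) : nat :=
  if s is b :: s' then ((a - b) + (b - a) + jumps_from b s')%N else 0%N.

Definition jumps (s : seq nat) : nat :=
  jumps_from (head 0%N s) (behead s).

(* [n (n + 1) - y - z - 2 p_1], written with [p_0 = n - 1]. *)
Definition jumps_poly : wpoly :=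
  [:: (1, [:: 3; 3]%N); (3, [:: 3%N]); (2, [::]);
      (-1, [:: 1%N]); (-1, [:: 2%N]); (-2, [:: 4%N])].

Definition jumps_pow (j : nat) : wpoly :=
  psubst (fun _ => jumps_poly) (nseq j 0%N).

(** For neighbours [a] and [b], [|a - b| + 2 (n - max(a, b)) = 2 n - a - b]. In the sum every value
    counts twice except the two end values. *)
Lemma jumps_from_gaps n a s :
  Z.of_nat (jumps_from a s) + 2 * powsum 1 (gaps n a s) =
  2 * Z.of_nat n * Z.of_nat (size s) - 2 * Z.of_nat (sumn (a :: s))
  + Z.of_nat a + Z.of_nat (last a s).
Proof.
elim: s a => [|b s IHs] a; first by rewrite /powsum /=; lia.
have := IHs b; rewrite /powsum /= /zpow /= maxnE; lia.
Qed.

Lemma peval_jumps n s : (0 < n)%N -> s \in perms n ->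
  peval (stat n s) jumps_poly = Z.of_nat (jumps s).
Proof.
move=> n0 sn; rewrite /peval /jumps_poly.
rewrite /zsum /foldr /fst /snd /weval /foldr stat_p0 //.
have sum_s : 2 * Z.of_nat (sumn s) = Z.of_nat n * (Z.of_nat n - 1).
  have: perm_eq s (iota 0 n) by rewrite -mem_perms.
  move/perm_sumn ->; elim: (n) => // m IHm.
  by rewrite -addn1 iotaD sumn_cat /=; lia.
have := perms_size sn; case: s sn sum_s => [|a s] sn sum_s.
  by move=> n_0; rewrite -n_0 in n0.
move=> /= sz; have := jumps_from_gaps n a s.
rewrite /jumps /= in sum_s *; lia.
Qed.

Lemma peval_jumps_pow n s j : (0 < n)%N -> s \in perms n ->
  peval (stat n s) (jumps_pow j) = zpow (Z.of_nat (jumps s)) j.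
Proof. by move=> n0 sn; rewrite peval_subst weval_nseq peval_jumps. Qed.

(** * Interpolation of the moments *)

(* The moments of degree at most 4, where the [k]-th power sum has degree [k],
   are polynomials in [n] of degree at most 8 for [n >= 4]: they are
   interpolated from their values at 4, ..., 12. *)
Definition degree (i : nat) : nat := if (i < 3)%N then 1%N else (i - 3)%N.

Definition words : seq (seq nat) :=
  [seq w <- flatten
      [seq iter j (allpairs cons [:: 1; 2; 4; 5; 6; 7]%N) [:: [::]]
      | j <- iota 0 5]
  | sorted leq w && (sumn (map degree w) <= 4)%N].

Definition totals := seq (seq nat * Z).

(** The recurrence on numbers: starting from the totals at 4, it yields those up to 12 without
    listing longer permutations. *)
Definition next_totals (n : nat) (t : totals) : totals :=
  [seq (w, zsum (fun u => u.1 * zpow (Z.of_nat n - 1) (count_mem 3%N u.2) *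
      (nth ([::], 0) t (index (reduced u.2) (map fst t))).2) (step w))
  | w <- map fst t].

Fixpoint totals_from (n k : nat) (t : totals) : seq totals :=
  if k is k'.+1 then t :: totals_from n.+1 k' (next_totals n t) else [:: t].

(** Newton's form at the nodes [x], [x + 1], ..., nested as in Horner's rule. The entries of [vs]
    are divided differences of order [j - 1]; the next ones involve nodes at distance [j]. *)
Fixpoint newton (x j : Z) (k : nat) (vs : seq Z) : seq Z :=
  match k, vs with
  | k'.+1, v :: vs' =>
      dadd [:: v] (dlin (- x) (newton (x + 1) (j + 1) k'
        (pairmap (fun a b => (b - a) / j) v vs')))
  | _, _ => [::]
  end.

(* 10! / 4, which makes all the divided differences integers. *)
Definition denominator : Z := 907200.

(** The product of 1, ..., [j + 4] is the number of permutations, which turns totals into means. The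
    outcome is certified afterwards by [closed_moment_table] and [moment_table_at4]. *)
Definition interpolated_table : table :=
  let ts := totals_from 4 8 [seq (w, total 4 [:: (1, w)]) | w <- words] in
  [seq (w, newton 4 1 9 [seq denominator *
             (nth ([::], 0) (nth [::] ts j) (index w words)).2
             / foldr Z.mul 1 (map Z.of_nat (iota 1 (j + 4))) | j <- iota 0 9])
  | w <- words].

Definition moment_table : table := Eval vm_compute in interpolated_table.

Lemma closed_moment_table : closed_table moment_table.
Proof. by vm_compute. Qed.

Lemma moment_table_at4 : moments_at 4 denominator moment_table.
Proof.
have : all (fun w => denominator * total 4 [:: (1, w)] =?
    Z.of_nat 4`! * deval (lookup moment_table w) (Z.of_nat 4))
  (map fst moment_table) by vm_compute.
by move/allP => H w /H /Z.eqb_eq.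
Qed.

(** * Moments of the sum of the jumps *)

Definition mean_jumps_pow (j : nat) : seq Z :=
  moment moment_table (jumps_pow j).

Lemma zsum_jumps_pow n j : (0 < n)%N ->
  zsum (fun s => zpow (Z.of_nat (jumps s)) j) (perms n) = total n (jumps_pow j).
Proof. by move=> n0; apply: eq_in_zsum => s sn; rewrite peval_jumps_pow. Qed.

Lemma jumps_moments n j : (4 <= n)%N -> (j <= 4)%N ->
  denominator * zsum (fun s => zpow (Z.of_nat (jumps s)) j) (perms n) =
  Z.of_nat n`! * deval (mean_jumps_pow j) (Z.of_nat n).
Proof.
move=> n4 j4; have n0 : (0 < n)%N by apply: leq_trans n4.
rewrite zsum_jumps_pow //; apply: total_moment => //.
  exact: moments_from closed_moment_table moment_table_at4 n4.
by do 5?[case: j j4 => [|j] j4; first by vm_compute].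
Qed.

(** The first two moments follow the same polynomials at [n = 2] and [n = 3], by enumeration; this
    gives the mean of the squared coefficient from [n = 2] on. *)
Lemma jumps_moments_le2 n j : (2 <= n)%N -> (j <= 2)%N ->
  denominator * zsum (fun s => zpow (Z.of_nat (jumps s)) j) (perms n) =
  Z.of_nat n`! * deval (mean_jumps_pow j) (Z.of_nat n).
Proof.
move=> n2 j2; have [n4|] := leqP 4 n.
  by apply: jumps_moments => //; apply: leq_trans j2 _.
case: n n2 => [|[|[|[|n]]]] // _ _;
by do 3?[case: j j2 => [|j] j2; first by vm_compute].
Qed.

(** Coefficients carry the factor [denominator], so 302400 stands for [1 / 3]. Zero leading
    coefficients remain because [dadd] does not trim. *)
Lemma mean_jumps_pow1 :
  mean_jumps_pow 1 = [:: -302400; 0; 302400] ++ nseq 8 0.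
Proof. by vm_compute. Qed.

Lemma mean_jumps_pow2 :
  mean_jumps_pow 2 = [:: 241920; -10080; -312480; 40320; 100800] ++ nseq 8 0.
Proof. by vm_compute. Qed.

Lemma mean_jumps_pow3 :
  mean_jumps_pow 3 =
  [:: -293760; -108000; 376320; -31680; -215520; 40320; 33600] ++ nseq 8 0.
Proof. by vm_compute. Qed.

Lemma mean_jumps_pow4 :
  mean_jumps_pow 4 =
  [:: 576000; 398304; -650176; -125760; 410400; -70464; -118464; 26880; 11200]
  ++ nseq 8 0.
Proof. by vm_compute. Qed.

End Jumps.

Local Open Scope classical_set_scope.
Local Open Scope ring_scope.

(** * Chatterjee's coefficient and permutations *)

(** Only the comparisons within each sample enter, which exhibits the coefficient as a function of
    finitely many booleans. *)
Definition rank_seq (n : nat) (a b : rel 'I_n) : seq nat :=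
  [seq (\sum_(j < n) b j i)%N | i <- sort a (enum 'I_n)].

Definition score (R : realType) (n v : nat) : R :=
  1 - 3 * v%:R / (n%:R ^+ 2 - 1).

Lemma jumpsE (R : realType) (s : seq nat) :
  \sum_(0 <= i < (size s).-1) `|(nth 0%N s i.+1)%:R - (nth 0%N s i)%:R : R| =
  (jumps s)%:R.
Proof.
case: s => [|a s]; first by rewrite big_geq.
rewrite /jumps /=; elim: s a => [|b s IHs] a; first by rewrite big_geq.
rewrite big_nat_recl //= natrD -IHs; congr (_ + _).
case: (leqP a b) => [ab|/ltnW ba].
  have /eqP -> : (a - b == 0)%N by [].
  by rewrite add0n natrB // ger0_norm // subr_ge0 ler_nat.
have /eqP -> : (b - a == 0)%N by [].
by rewrite addn0 distrC natrB // ger0_norm // subr_ge0 ler_nat.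
Qed.

(** Ranks start at 1, the values of a permutation at 0. *)
Lemma jumps_map_succ s : jumps (map S s) = jumps s.
Proof.
case: s => // a s; rewrite /jumps /=.
by elim: s a => //= b s IHs a; rewrite IHs.
Qed.

Definition perm_values (n : nat) (s : 'S_n) : seq nat :=
  [seq val (s i) | i <- enum 'I_n].

Lemma perm_values_inj n : injective (@perm_values n).
Proof.
move=> s t /eq_in_map st; apply/permP => i; apply/val_inj/st.
by rewrite mem_enum.
Qed.

(** Both lists are free of duplicates and have length [n!], so one inclusion suffices. *)
Lemma perm_values_perms n :
  perm_eq [seq perm_values s | s <- enum 'S_n] (perms n).
Proof.
have us : uniq [seq perm_values s | s <- enum 'S_n].
  by rewrite (map_inj_uniq (@perm_values_inj n)) enum_uniq.
apply: uniq_perm => //; first exact: uniq_perms.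
have sub : {subset [seq perm_values s | s <- enum 'S_n] <= perms n}.
  move=> s /mapP[t _ ->]; rewrite mem_perms /perm_values.
  rewrite (map_comp val t) -[X in perm_eq _ X]val_enum_ord perm_map //.
  apply: uniq_perm; rewrite ?(map_inj_uniq (@perm_inj _ t)) ?enum_uniq //.
  by move=> i; rewrite [RHS]mem_enum -(permKV t i) map_f ?mem_enum.
have le : (size (perms n) <= size [seq perm_values s | s <- enum 'S_n])%N.
  by rewrite size_perms size_map -cardE card_Sn.
by have [_] := uniq_min_size us sub le.
Qed.

(** * Orderings of the two samples and the coefficient *)

Section Scores.
Variables (R : realType) (n : nat).
Implicit Types (x y : 'I_n -> R) (s t : 'S_n).

Lemma concomitant_rankE x y i : (i < n)%N ->
  concomitant_rank x y i =
  nth 0%N (rank_seq (fun i j => x i <= x j) (fun i j => y i <= y j)) i.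
Proof.
move=> i_n; pose i0 : 'I_n := Ordinal i_n.
set a := fun i j => x i <= x j.
have sz : size (sort a (enum 'I_n)) = n by rewrite size_sort size_enum_ord.
have conc j : (j < n)%N ->
    concomitant x y j = y (nth i0 (sort a (enum 'I_n)) j).
  move=> jn; rewrite /concomitant /rearranged_pairs sort_map.
  by rewrite (nth_map i0) ?sz.
rewrite /rank_seq (nth_map i0) ?sz // /concomitant_rank conc //.
pose f j : nat := y j <= y (nth i0 (sort a (enum 'I_n)) i).
transitivity (\sum_(j <- sort a (enum 'I_n)) f j)%N; last first.
  by rewrite (perm_big (enum 'I_n)) ?perm_sort //= big_enum.
rewrite (big_nth i0) sz big_mkord; apply: eq_bigr => j _.
by rewrite conc.
Qed.

Lemma chatterjeeE x y : chatterjee x y =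
  score R n (jumps (rank_seq (fun i j => x i <= x j) (fun i j => y i <= y j))).
Proof.
rewrite /chatterjee /score -jumpsE size_map size_sort size_enum_ord.
congr (1 - 3 * _ / _); apply: eq_big_nat => i /andP[_ i_n].
have i1n : (i.+1 < n)%N by case: (n) i_n.
by rewrite !concomitant_rankE // ltnW.
Qed.

Definition increasing x s : bool :=
  [forall i : 'I_n, forall j : 'I_n, (i < j)%N ==> (x (s i) < x (s j))].

Lemma increasing_le x s i j : increasing x s ->
  (x (s i) <= x (s j)) = (i <= j)%N.
Proof.
move=> /forallP xs; have lt (k l : 'I_n) : (k < l)%N -> x (s k) < x (s l).
  by move=> kl; apply: (implyP (forallP (xs k) l)).
case: (ltngtP i j) => [/lt/ltW //|/lt|/val_inj ->]; last by rewrite lexx.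
by rewrite ltNge => /negbTE.
Qed.

(** Strict growth along [s] rules out ties, so the comparison is antisymmetric and the sorted list
    is unique. *)
Lemma sort_increasing x s : increasing x s ->
  sort (fun i j => x i <= x j) (enum 'I_n) = [seq s i | i <- enum 'I_n].
Proof.
move=> xs; pose a : rel 'I_n := fun i j => x i <= x j.
have a_anti : antisymmetric a.
  move=> i j; rewrite /a -(permKV s i) -(permKV s j) !increasing_le //.
  by rewrite -eqn_leq => /eqP/val_inj ->.
apply: (@sorted_eq _ a) => //.
- by move=> i j k; rewrite /a; apply: le_trans.
- by apply: sort_sorted => i j; apply: le_total.
- rewrite sorted_map (@eq_sorted _ _ (relpre val leq)); last first.
    by move=> i j; rewrite /a /= increasing_le.
  by rewrite -(@sorted_map _ _ val) val_enum_ord iota_sorted.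
rewrite perm_sort perm_sym; apply: uniq_perm.
- by rewrite (map_inj_uniq (@perm_inj _ s)) enum_uniq.
- exact: enum_uniq.
by move=> i; rewrite [RHS]mem_enum -(permKV s i) map_f ?mem_enum.
Qed.

Lemma increasing_inj x s t : increasing x s -> increasing x t -> s = t.
Proof.
move=> /sort_increasing xs /sort_increasing; rewrite xs => /eq_in_map st.
by apply/permP => i; apply: st; rewrite mem_enum.
Qed.

Lemma increasing_exists x : injective x -> exists s, increasing x s.
Proof.
move=> x_inj; pose a : rel 'I_n := fun i j => x i <= x j.
have sz : size (sort a (enum 'I_n)) == n by rewrite size_sort size_enum_ord.
have us : uniq (sort a (enum 'I_n)) by rewrite sort_uniq enum_uniq.
have s_inj : injective (tnth (Tuple sz)) by apply/tuple_uniqP.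
exists (perm s_inj); apply/forallP => i; apply/forallP => j; apply/implyP => ij.
have sij : perm s_inj i != perm s_inj j.
  by rewrite (inj_eq perm_inj) neq_ltn ij.
rewrite lt_neqAle (inj_eq x_inj) sij /= !permE !(tnth_nth i) /=.
have a_tr : transitive a by move=> k l m; rewrite /a; apply: le_trans.
have a_sorted : sorted a (sort a (enum 'I_n)).
  by apply: sort_sorted => k l; apply: le_total.
by apply: (sorted_ltn_nth a_tr i a_sorted) => //; rewrite inE (eqP sz).
Qed.

(** The observation at position [i] for [x] has index [s i] and sits at position [t^-1 (s i)] for
    [y]. Its rank is that position plus 1, a shift that leaves the jumps unchanged. *)
Lemma chatterjee_increasing x y s t : increasing x s -> increasing y t ->
  chatterjee x y = score R n (jumps (perm_values (s * t^-1)%g)).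
Proof.
move=> xs yt; rewrite chatterjeeE; congr (score _ _ _).
rewrite -[RHS]jumps_map_succ /rank_seq (sort_increasing xs) -!map_comp.
congr jumps; apply: eq_map => i; rewrite /= permM.
rewrite -{1}(permKV t (s i)) (reindex_inj (@perm_inj _ t)) /=.
under eq_bigr do rewrite (increasing_le _ _ yt).
set k := (t^-1)%g _.
rewrite (eq_bigr (fun j : 'I_n => if (j < k.+1)%N then 1%N else 0%N)) //.
rewrite -big_mkcond -(big_ord_widen n (fun=> 1%N) (ltn_ord k)).
by rewrite sum1_card card_ord.
Qed.

End Scores.

(** * Probability *)

Section Laws.
Context d (T : measurableType d) (R : realType) (P : probability T R).

(** For [s < r] the mass of [r] is at most [cdf X r - cdf X s], which tends to 0 as [s] tends to [r]
    from the left. *)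
Lemma atomless (X : {RV P >-> R}) r : continuous (cdf X) ->
  P (X @^-1` [set r]) = 0%E.
Proof.
move=> cX; pose mu := distribution P X.
have fin s : cdf X s \is a fin_num by apply: fin_num_measure.
have le s : s < r -> (mu [set r] <= cdf X r - cdf X s)%E.
  move=> sr; rewrite leeBrDr //.
  have := @measureU _ _ _ mu [set r] `]-oo, s]%classic
    (measurable_set1 _) (measurable_itv _).
  have -> : [set r] `&` `]-oo, s]%classic = set0.
    by apply/seteqP; split => // z [/= ->]; rewrite in_itv /= leNgt sr.
  move=> /(_ erefl) <-; apply: le_measure; rewrite ?inE //.
    by apply: measurableU.
  move=> z [/= ->|/=]; rewrite !in_itv //= => zs.
  exact: le_trans zs (ltW sr).
apply/eqP; rewrite -measure_le0 leNgt; apply/negP => mu_gt0.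
have cr : fine (cdf X s) @[s --> r^'-] --> fine (cdf X r).
  apply: cvg_at_left_filter; apply: fine_cvg; rewrite fineK //; exact: cX.
have p_gt0 : 0 < fine (mu [set r]).
  by rewrite fine_gt0 // mu_gt0 ltey_eq fin_num_measure.
have : \forall s \near r^'-,
    fine (cdf X r) - fine (cdf X s) < fine (mu [set r]).
  near=> s.
  have : `|fine (cdf X r) - fine (cdf X s)| < fine (mu [set r]).
    by near: s; apply: (cvgr_dist_lt _ _ cr _ p_gt0).
  exact: le_lt_trans (ler_norm _).
move=> H; near r^'- => s.
have : fine (cdf X r) - fine (cdf X s) < fine (mu [set r]) by near: s.
apply/negP; rewrite -leNgt -lee_fin EFinB !fineK ?fin_num_measure //.
by apply: le; near: s; apply: nbhs_left_lt.
Unshelve. all: by end_near. Qed.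

(** The joint law is the product of the marginals; by Fubini the diagonal has the integral of the
    masses of single points under the law of [V] as its measure. *)
Lemma independent_neq (U V : {RV P >-> R}) :
  (forall A B, measurable A -> measurable B ->
     P (U @^-1` A `&` V @^-1` B) = (P (U @^-1` A) * P (V @^-1` B))%E) ->
  (forall r, P (V @^-1` [set r]) = 0%E) ->
  P [set w | U w = V w] = 0%E.
Proof.
move=> indep V0.
pose D : set (R * R) := [set z | z.1 = z.2].
have mD : measurable D.
  rewrite (_ : D = [set z | z.1 == z.2]); last first.
    by apply/seteqP; split=> z /= /eqP.
  have mE : measurable_fun setT (fun z : R * R => z.1 == z.2).
    by apply: measurable_fun_eqr.
  by have := mE measurableT [set true] I; rewrite setTI.
have mUV : measurable_fun setT (fun w => (U w, V w)).
  by apply/measurable_fun_pairP; split => /=; apply: measurable_funP.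
pose W : {mfun T >-> (R * R)%type} :=
  HB.pack (fun w => (U w, V w)) (isMeasurableFun.Build _ _ _ _ _ mUV).
rewrite -[LHS]/(distribution P W D).
rewrite -(@product_measure_unique _ _ _ _ _ (distribution P U)
  (distribution P V)) // /product_measure1 integral0_eq // => u _ /=.
rewrite (_ : xsection D u = [set u]); last first.
  by apply/seteqP; split=> v; rewrite /xsection /= inE /D /= => ->.
exact: V0.
Qed.

(* Boxes generate the product sigma-algebra of the tuples. *)
Lemma eq_law_tuple (m : nat) (U V : {mfun T >-> m.-tuple R}) :
  (forall B : 'I_m -> set R, (forall i, measurable (B i)) ->
     P (\bigcap_(i in [set: 'I_m]) [set w | B i (tnth (U w) i)]) =
     P (\bigcap_(i in [set: 'I_m]) [set w | B i (tnth (V w) i)])) ->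
  forall E : set (m.-tuple R), measurable E -> P (U @^-1` E) = P (V @^-1` E).
Proof.
move=> UV; pose box (B : 'I_m -> set R) : set (m.-tuple R) :=
  \bigcap_(i in [set: 'I_m]) [set z | B i (tnth z i)].
pose G : set (set (m.-tuple R)) :=
  [set E | exists2 B, (forall i, measurable (B i)) & E = box B].
have mG B : (forall i, measurable (B i)) -> measurable (box B).
  move=> mB; apply: fin_bigcap_measurable => // i _.
  have := @measurable_tnth _ R m i measurableT _ (mB i).
  by rewrite setTI.
apply: (@measure_unique _ _ _ G (fun=> setT) _ _ _ _ (distribution P U)
  (distribution P V)).
- apply/seteqP; split; last first.
    apply: smallest_sub; first exact: sigma_algebra_measurable.
    by move=> _ [B mB ->]; apply: mG.
  apply: smallest_sub; first exact: smallest_sigma_algebra.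
  move=> E; rewrite -bigcup_seq => -[/= i _ [B mB <-]].
  apply: sub_sigma_algebra; exists (fun j => if j == i then B else setT).
    by move=> j; case: ifP.
  apply/seteqP; split=> z /=; first by move=> [_ Bz] j _ /=; case: eqP => // ->.
  by move=> /(_ i I) /=; rewrite eqxx.
- move=> _ _ [A mA ->] [B mB ->]; exists (fun i => A i `&` B i).
    by move=> i; apply: measurableI.
  by rewrite /box -bigcapI.
- move=> _; exists (fun=> setT) => //.
  by apply/seteqP; split.
- by rewrite bigcup_const.
- by move=> _ [B mB ->]; apply: UV.
by move=> _; rewrite /= probability_setT ltry.
Qed.

End Laws.

(** * Invariance of the samples under permutations *)

Section Copies.
Context (R : realType) (d : measure_display) (T : measurableType d)
  (P : probability T R) (n p : nat)
  (X : 'I_p -> {RV P >-> R}) (Xs : 'I_n -> 'I_p -> {RV P >-> R}) (k l : 'I_p).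
Hypothesis X_indep : mutually_independent P (fun j => X j : T -> R).
Hypothesis X_cont : forall j, continuous (cdf (X j)).
Hypothesis X_copies :
  iid_copies P (fun i j => Xs i j : T -> R) (fun j => X j : T -> R).
Hypothesis kl : k != l.

Lemma measurable_pair_box (A B : set R) : measurable A -> measurable B ->
  measurable [set z : p.-tuple R | A (tnth z k) /\ B (tnth z l)].
Proof.
move=> mA mB.
have mk := @measurable_tnth _ R p k measurableT _ mA.
have ml := @measurable_tnth _ R p l measurableT _ mB.
by have := measurableI _ _ mk ml; rewrite !setTI.
Qed.

Lemma pair_law i (A B : set R) : measurable A -> measurable B ->
  P (random_vector (fun j => Xs i j : T -> R) @^-1`
       [set z | A (tnth z k) /\ B (tnth z l)]) =
  (P (X k @^-1` A) * P (X l @^-1` B))%E.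
Proof.
move=> mA mB; rewrite X_copies.2; last exact: measurable_pair_box.
pose C (j : 'I_p) := if j == k then A else B.
have := @X_indep [set k; l]%SET C.
rewrite big_setU1 ?big_set1 ?inE //= /C eqxx eq_sym (negPf kl) => <-.
  congr (P _); apply/seteqP; split=> w /=; rewrite !tnth_mktuple.
    by move=> [Aw Bw] j /=; rewrite !inE => /orP[]/eqP->;
      rewrite ?eqxx // eq_sym (negPf kl).
  by move=> H; split; [have := H k | have := H l];
    rewrite /= !inE eqxx ?orbT ?[l == k]eq_sym ?(negPf kl) => /(_ isT).
by move=> j _; case: ifP.
Qed.

(** Independence between the copies gives a product over [i], and independence of coordinates [k]
    and [l] splits each factor. *)
Lemma box_law (A B : 'I_n -> set R) :
  (forall i, measurable (A i)) -> (forall i, measurable (B i)) ->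
  P (\bigcap_(i in [set: 'I_n]) [set w | A i (Xs i k w) /\ B i (Xs i l w)]) =
  (\prod_(i < n) P (X k @^-1` A i) * \prod_(i < n) P (X l @^-1` B i))%E.
Proof.
move=> mA mB.
have := @X_copies.1 [set: 'I_n]%SET
  (fun i => [set z : p.-tuple R | A i (tnth z k) /\ B i (tnth z l)]).
rewrite (eq_bigl xpredT) => [|i]; last by rewrite inE.
under eq_bigr do rewrite pair_law //.
rewrite big_split /= => <-; last by move=> i _; apply: measurable_pair_box.
congr (P _); apply/seteqP; split=> w H i /= _.
  by rewrite !tnth_mktuple; apply: H.
by have := H i; rewrite /= !tnth_mktuple inE; apply.
Qed.

Lemma pair_law1 i j (A : set R) : measurable A ->
  P (Xs i j @^-1` A) = P (X j @^-1` A).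
Proof.
move=> mA; have mj := @measurable_tnth _ R p j measurableT _ mA.
rewrite setTI in mj; have := X_copies.2 i _ mj.
by rewrite /preimage /=; under eq_set do rewrite tnth_mktuple;
  under [in RHS]eq_set do rewrite tnth_mktuple.
Qed.

Lemma no_ties i i' j : i != i' -> P [set w | Xs i j w = Xs i' j w] = 0%E.
Proof.
move=> ii'; apply: independent_neq => [A B mA mB|r].
  pose C m : set (p.-tuple R) :=
    (fun z => tnth z j) @^-1` (if m == i then A else B).
  have mC m : measurable (C m).
    rewrite /C -[X in measurable X]setTI.
    by apply: (@measurable_tnth _ R p j) => //; case: ifP.
  have := @X_copies.1 [set i; i']%SET C (fun m _ => mC m).
  rewrite big_setU1 ?big_set1 ?inE //= /C eqxx eq_sym (negPf ii').
  have rvE m (Y : set R) : random_vector (fun j => Xs m j : T -> R) @^-1`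
      ((fun z => tnth z j) @^-1` Y) = Xs m j @^-1` Y.
    by rewrite /preimage /=; apply/seteqP; split => w /=; rewrite tnth_mktuple.
  rewrite !rvE => <-; congr (P _); apply/seteqP; split=> w /=.
    move=> [Aw Bw] m /=; rewrite !inE => /orP[]/eqP-> /=;
    by rewrite tnth_mktuple ?eqxx // eq_sym (negPf ii').
  move=> H; split; [have := H i | have := H i'];
    rewrite /= !inE eqxx ?orbT ?[i' == i]eq_sym ?(negPf ii') tnth_mktuple;
    exact.
by rewrite pair_law1 //; apply: atomless.
Qed.

(** The two permuted samples form one vector of length [n + n], whose law can be compared on
    boxes. *)
Definition coord (s t : 'S_n) (a : 'I_(n + n)) : {RV P >-> R} :=
  match fintype.split a with inl i => Xs (s i) k | inr i => Xs (t i) l end.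

Lemma coord_lshift s t i : coord s t (lshift n i) = Xs (s i) k.
Proof. by rewrite /coord (unsplitK (inl i)). Qed.

Lemma coord_rshift s t i : coord s t (rshift n i) = Xs (t i) l.
Proof. by rewrite /coord (unsplitK (inr i)). Qed.

(** Reindexing by the inverses of [s] and [t] reduces to a box for the original samples. The value
    is free of [s] and [t]: this is the invariance in law. *)
Lemma coord_box_law s t (B : 'I_(n + n) -> set R) :
  (forall a, measurable (B a)) ->
  P (\bigcap_(a in [set: 'I_(n + n)]) [set w | B a (coord s t a w)]) =
  (\prod_(i < n) P (X k @^-1` B (lshift n i)) *
   \prod_(i < n) P (X l @^-1` B (rshift n i)))%E.
Proof.
move=> mB; rewrite [in RHS](reindex_inj (@perm_inj _ s^-1%g)) /=.
rewrite [X in (_ * X)%E](reindex_inj (@perm_inj _ t^-1%g)) /= -box_law //.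
congr (P _); apply/seteqP; split=> w H.
  move=> i _ /=; split.
    by have := H (lshift n (s^-1%g i)) I; rewrite /= coord_lshift permKV.
  by have := H (rshift n (t^-1%g i)) I; rewrite /= coord_rshift permKV.
move=> a _ /=; rewrite -(splitK a); case: (fintype.split a) => i /=.
  by rewrite coord_lshift; have [+ _] := H (s i) I; rewrite /= permK.
by rewrite coord_rshift; have [_ +] := H (t i) I; rewrite /= permK.
Qed.

Lemma perm_law s t (E : set ((n + n).-tuple R)) : measurable E ->
  P [set w | E [tuple coord s t a w | a < n + n]] =
  P [set w | E [tuple coord 1%g 1%g a w | a < n + n]].
Proof.
move=> mE.
have mcoord s' t' : measurable_fun [set: T]
    (fun w => [tuple coord s' t' a w | a < n + n]).
  apply/measurable_fun_tnthP => a.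
  rewrite (_ : _ \o _ = coord s' t' a); first exact: measurable_funP.
  by apply/funext => w /=; rewrite tnth_mktuple.
pose V s' t' : {mfun T >-> (n + n).-tuple R} :=
  HB.pack (fun w => [tuple coord s' t' a w | a < n + n])
    (isMeasurableFun.Build _ _ _ _ _ (mcoord s' t')).
apply: (eq_law_tuple (U := V s t) (V := V 1%g 1%g)) => // B mB.
have box s' t' :
    \bigcap_(i in [set: 'I_(n + n)]) [set w | B i (tnth (V s' t' w) i)] =
    \bigcap_(i in [set: 'I_(n + n)]) [set w | B i (coord s' t' i w)].
  by apply: eq_bigcapr => i _; apply/seteqP; split=> w /=; rewrite tnth_mktuple.
by rewrite !box !coord_box_law.
Qed.

Definition order_event (q : 'S_n * 'S_n) : set T :=
  [set w | increasing (fun i => Xs i k w) q.1 /\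
           increasing (fun i => Xs i l w) q.2].

Lemma measurable_increasing d' (U : measurableType d') (x : 'I_n -> U -> R) s :
  (forall i, measurable_fun [set: U] (x i)) ->
  measurable [set u | increasing (x^~ u) s].
Proof.
move=> mx; rewrite (_ : [set u | _] =
  \bigcap_(i in [set: 'I_n]) \bigcap_(j in [set j : 'I_n | (i < j)%N])
    [set u | x (s i) u < x (s j) u]).
  apply: fin_bigcap_measurable => // i _.
  apply: fin_bigcap_measurable => // j _.
  have := @measurable_fun_ltr _ _ _ _ _ _ (mx (s i)) (mx (s j))
    measurableT [set true] I.
  by rewrite setTI.
apply/seteqP; split=> u /=.
  by move=> /forallP H i _ j /= ij; apply: (implyP (forallP (H i) j)).
by move=> H; apply/forallP => i; apply/forallP => j; apply/implyP => /H; apply.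
Qed.

Lemma measurable_order_event q : measurable (order_event q).
Proof.
by apply: measurableI; apply: measurable_increasing => i;
  apply: measurable_funP.
Qed.

(** The event for [(s, t)] is one fixed set [E] evaluated at the samples permuted by [s] and [t]. *)
Lemma order_event_law q : P (order_event q) = P (order_event (1%g, 1%g)).
Proof.
pose E : set ((n + n).-tuple R) :=
  [set z | increasing (fun i => tnth z (lshift n i)) 1%g] `&`
  [set z | increasing (fun i => tnth z (rshift n i)) 1%g].
have mE : measurable E.
  by apply: measurableI; apply: measurable_increasing => i;
    apply: measurable_tnth.
have ev s t : order_event (s, t) =
    [set w | E [tuple coord s t a w | a < n + n]].
  have inc (x : 'I_n -> R) r : increasing x r = increasing (x \o r) 1%g.
    by apply: eq_forallb => i; apply: eq_forallb => j; rewrite /= !perm1.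
  rewrite /order_event /E; congr (_ `&` _); apply/funext => w /=; rewrite inc;
    congr (is_true (increasing _ _)); apply/funext => i /=;
    by rewrite tnth_mktuple ?coord_lshift ?coord_rshift.
by case: q => s t; rewrite !ev perm_law.
Qed.

Lemma ae_order_event : {ae P, forall w, exists q, order_event q w}.
Proof.
have ties i i' j : {ae P, forall w, i != i' -> Xs i j w != Xs i' j w}.
  have [<-|ii'] := eqVneq i i'; first exact: aeW.
  exists [set w | Xs i j w = Xs i' j w]; split=> [||w /= H].
  - have := @measurable_fun_eqr _ _ _ _ _ _ (@measurable_funPT _ _ _ _ (Xs i j))
      (@measurable_funPT _ _ _ _ (Xs i' j)) measurableT [set true] I.
    by rewrite setTI; congr measurable; apply/seteqP; split=> w /= /eqP.
  - exact: no_ties.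
  by apply: contrapT => neq; apply: H => _; apply/eqP.
have inj j : {ae P, forall w, injective (fun i => Xs i j w)}.
  have : {ae P, forall w i i', i != i' -> Xs i j w != Xs i' j w}.
    by apply: filter_forall => i; apply: filter_forall => i'; apply: ties.
  apply: filterS => w H i i' /eqP ii'; apply/eqP; apply: contraTT ii'; exact: H.
apply: filterS2 (inj k) (inj l) => w /increasing_exists[s xs].
by move=> /increasing_exists[t yt]; exists (s, t).
Qed.

(** * Expectation of functions of the coefficient *)

Definition xi (w : T) : R := chatterjee (fun i => Xs i k w) (fun i => Xs i l w).

(** The coefficient factors through the finite pattern of comparisons, so every preimage is a finite
    union of measurable events, whatever [F] is. *)
Lemma measurable_comp_xi (F : R -> R) : measurable_fun [set: T] (F \o xi).
Proof.
pose pat w : {ffun 'I_n * 'I_n -> bool * bool} :=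
  [ffun q => (Xs q.1 k w <= Xs q.2 k w, Xs q.1 l w <= Xs q.2 l w)].
pose G (c : {ffun 'I_n * 'I_n -> bool * bool}) := F (score R n
  (jumps (rank_seq (fun i j => (c (i, j)).1) (fun i j => (c (i, j)).2)))).
have mpat c : measurable (pat @^-1` [set c]).
  rewrite (_ : _ @^-1` _ = \bigcap_(q in [set: 'I_n * 'I_n])
    ([set w | (Xs q.1 k w <= Xs q.2 k w) == (c q).1] `&`
     [set w | (Xs q.1 l w <= Xs q.2 l w) == (c q).2])).
    apply: fin_bigcap_measurable => // q _.
    have m j b : measurable [set w | (Xs q.1 j w <= Xs q.2 j w) == b].
      have := @measurable_fun_ler _ _ _ _ _ _
        (@measurable_funPT _ _ _ _ (Xs q.1 j))
        (@measurable_funPT _ _ _ _ (Xs q.2 j)) measurableT [set b] I.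
      by rewrite setTI; congr measurable; apply/seteqP; split=> w /= /eqP.
    exact: measurableI.
  apply/seteqP; split=> w /=.
    by move=> patc q _ /=; rewrite -patc ffunE.
  move=> H; apply/ffunP => q; have [/= /eqP H1 /eqP H2] := H q I.
  by rewrite ffunE H1 H2; case: (c q).
move=> _ Y _; rewrite setTI.
rewrite (_ : _ @^-1` Y = \bigcup_(c in [set c | Y (G c)]) (pat @^-1` [set c])).
  by apply: fin_bigcup_measurable.
have GE w : (F \o xi) w = G (pat w).
  rewrite /= /xi chatterjeeE; congr (F (score _ _ (jumps (rank_seq _ _))));
    by apply/funext => i; apply/funext => j; rewrite ffunE.
apply/seteqP; split=> w /=; first by rewrite -/((F \o xi) w) GE; exists (pat w).
by move=> [c /= Yc patc]; rewrite -/((F \o xi) w) GE patc.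
Qed.

(** The order events are disjoint, cover almost every outcome and are equally likely; the
    coefficient is constant on each. *)
Lemma expectation_order_events (F : R -> R) :
  ('E_P[F \o xi] = \sum_(q : 'S_n * 'S_n)
     (F (score R n (jumps (perm_values (q.1 * q.2^-1)%g))))%:E
     * P (order_event (1%g, 1%g)))%E.
Proof.
have mF := measurable_comp_xi F.
pose D : set T := \big[setU/set0]_(q <- enum {: 'S_n * 'S_n}) order_event q.
have mD : measurable D.
  by apply: bigsetU_measurable => q _; apply: measurable_order_event.
have mFD : measurable_fun D (F \o xi) by apply: measurable_funS mF.
rewrite unlock (ae_eq_integral (((EFin \o (F \o xi))) \_ D)) //; last 3 first.
- exact/measurable_EFinP.
- by apply/(measurable_restrictT _ mD); apply/measurable_EFinP.
- apply: filterS ae_order_event => w [q qw] _.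
  rewrite patchE ifT // inE /D -bigcup_seq; exists q => //=.
  by rewrite mem_enum.
rewrite -integral_mkcond integral_bigsetU_EFin //; last 4 first.
- exact: measurable_order_event.
- exact: enum_uniq.
- move=> q r _ _ [w [[/= q1 q2] [/= r1 r2]]].
  rewrite (surjective_pairing q) (surjective_pairing r).
  by rewrite (increasing_inj q1 r1) (increasing_inj q2 r2).
- exact/measurable_EFinP.
rewrite big_enum; apply: eq_bigr => q _.
rewrite (eq_integral (cst
  (F (score R n (jumps (perm_values (q.1 * q.2^-1)%g))))%:E)).
  have mq := measurable_order_event q; rewrite integral_cst //.
  by congr (_ * _)%E; apply: order_event_law.
move=> w; rewrite inE => -[/= xs yt].
by rewrite /xi (chatterjee_increasing xs yt).
Qed.

Lemma expectation_xi (F : R -> R) :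
  'E_P[F \o xi]%E =
  ((\sum_(s : 'S_n) F (score R n (jumps (perm_values s)))) / n`!%:R)%:E.
Proof.
pose c := fine (P (order_event (1%g, 1%g))).
have E (G : R -> R) : 'E_P[G \o xi]%E =
    (n`!%:R * (\sum_(s : 'S_n) G (score R n (jumps (perm_values s)))) * c)%:E.
  rewrite expectation_order_events -[P _]fineK ?fin_num_measure //; last first.
    exact: measurable_order_event.
  under eq_bigr do rewrite -EFinM.
  rewrite sumEFin -mulr_suml -/c; congr (_ * c)%:E.
  rewrite -(pair_bigA _ (fun s t : 'S_n =>
    G (score R n (jumps (perm_values (s * t^-1)%g))))) /= exchange_big /=.
  rewrite -card_Sn -sum1_card natr_sum mulr_suml.
  (* For fixed [t], the product [s * t^-1] runs over all permutations, so each of the [n!] values of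
     [t] contributes the same sum. *)
  apply: eq_bigr => t _; rewrite mul1r (reindex_inj (mulIg t)).
  by apply: eq_bigr => s _; rewrite mulgK.
(* The constant function 1 gives [n! * n! * c = 1], which determines the common probability [c]. *)
have := E (fun=> 1); rewrite (_ : _ \o _ = cst 1) // expectation_cst.
rewrite sumr_const card_Sn => -[nc].
have n_neq0 : n`!%:R != 0 :> R by rewrite pnatr_eq0 -lt0n fact_gt0.
rewrite E; congr _%:E; apply: (mulIf n_neq0); rewrite mulfVK //.
rewrite -[RHS]mulr1 [X in _ = _ * X]nc [_ * c * _]mulrAC -!mulrA mulrCA.
by congr (_ * _); rewrite mulrCA.
Qed.

End Copies.

(** * Closed forms *)

From mathcomp Require Import ring lra.

Section Means.
Variable R : realType.

(** Binary recursion lets simplification turn the integer coefficients of the table into expressions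
    of [R] that [lra] can read. *)
Fixpoint of_pos (q : positive) : R :=
  match q with
  | xH => 1
  | xO q' => 2 * of_pos q'
  | xI q' => 2 * of_pos q' + 1
  end.

Definition of_Z (z : Z) : R :=
  match z with Z0 => 0 | Zpos q => of_pos q | Zneg q => - of_pos q end.

Lemma of_ZE z : of_Z z = (int_of_Z z)%:~R.
Proof.
have intD x y : int_of_Z (Z.add x y) = int_of_Z x + int_of_Z y.
  exact: (rmorphD int_of_Z).
have intM x y : int_of_Z (Z.mul x y) = int_of_Z x * int_of_Z y.
  exact: (rmorphM int_of_Z).
have intN x : int_of_Z (Z.opp x) = - int_of_Z x by exact: (rmorphN int_of_Z).
have posE q : of_pos q = (int_of_Z (Zpos q))%:~R.
  elim: q => [q IHq|q IHq|//]; rewrite [of_pos _]/= IHq.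
    by rewrite Pos2Z.inj_xI intD intM intrD intrM.
  by rewrite Pos2Z.inj_xO intM intrM.
case: z => [//|q|q]; rewrite /of_Z posE //.
by rewrite -Pos2Z.opp_pos intN mulrNz.
Qed.

Lemma of_ZD x y : of_Z (Z.add x y) = of_Z x + of_Z y.
Proof. by rewrite !of_ZE (rmorphD int_of_Z) intrD. Qed.

Lemma of_ZM x y : of_Z (Z.mul x y) = of_Z x * of_Z y.
Proof. by rewrite !of_ZE (rmorphM int_of_Z) intrM. Qed.

Lemma of_Z_nat k : of_Z (Z.of_nat k) = k%:R.
Proof.
elim: k => // k IHk; rewrite Nat2Z.inj_succ -Z.add_1_l of_ZD IHk.
by rewrite -natr1 addrC.
Qed.

Lemma of_Z_pow x j : of_Z (zpow x j) = of_Z x ^+ j.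
Proof. by elim: j => // j IHj; rewrite exprS -IHj -of_ZM. Qed.

Lemma of_Z_deval q x :
  of_Z (deval q x) = foldr (fun c a => of_Z c + of_Z x * a) 0 q.
Proof. by elim: q => //= c q <-; rewrite of_ZD of_ZM. Qed.

Lemma of_Z_zsum (T : Type) (f : T -> Z) (s : seq T) :
  of_Z (zsum f s) = \sum_(x <- s) of_Z (f x).
Proof.
by elim: s => [|x s IHs]; rewrite ?big_nil ?big_cons //= of_ZD IHs.
Qed.

Definition mean_jumps (n j : nat) : R :=
  (\sum_(s : 'S_n) (jumps (perm_values s))%:R ^+ j) / n`!%:R.

Lemma mean_jumpsE n j :
  (2 <= n)%N -> (j <= 4)%N -> (4 <= n)%N || (j <= 2)%N ->
  of_Z denominator * mean_jumps n j =
  of_Z (deval (mean_jumps_pow j) (Z.of_nat n)).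
Proof.
move=> n2 j4 nj.
have E : Z.mul denominator
    (zsum (fun s => zpow (Z.of_nat (jumps s)) j) (perms n)) =
    Z.mul (Z.of_nat n`!) (deval (mean_jumps_pow j) (Z.of_nat n)).
  by case/orP: nj => [/jumps_moments|/(jumps_moments_le2 n2)]; apply.
have n_neq0 : n`!%:R != 0 :> R by rewrite pnatr_eq0 -lt0n fact_gt0.
apply: (mulfI n_neq0); rewrite -{2}of_Z_nat -of_ZM -E of_ZM of_Z_zsum.
rewrite -(perm_big _ (perm_values_perms n)) big_map big_enum /mean_jumps /=.
under [in RHS]eq_bigr do rewrite of_Z_pow of_Z_nat.
by rewrite mulrCA [X in _ * X]mulrC mulfVK.
Qed.

Lemma mean_polynomial n (c0 c1 c2 c3 c4 : R) :
  (\sum_(s : 'S_n) (c0 + c1 * (jumps (perm_values s))%:R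
     + c2 * (jumps (perm_values s))%:R ^+ 2
     + c3 * (jumps (perm_values s))%:R ^+ 3
     + c4 * (jumps (perm_values s))%:R ^+ 4)) / n`!%:R =
  c0 + c1 * mean_jumps n 1 + c2 * mean_jumps n 2 + c3 * mean_jumps n 3
     + c4 * mean_jumps n 4.
Proof.
rewrite !big_split /= -!mulr_sumr sumr_const card_Sn !mulrDl -!mulrA.
congr (_ + _ + _ + _ + _); rewrite -[_ *+ _]mulr_natr mulfK //.
Qed.

Lemma mean_jumps1 n : (2 <= n)%N -> mean_jumps n 1 = (n%:R ^+ 2 - 1) / 3.
Proof.
move=> n2; have := @mean_jumpsE n 1 n2 isT (orbT _).
rewrite of_Z_deval of_Z_nat mean_jumps_pow1 /=.
lra.
Qed.

Lemma mean_jumps2 n : (2 <= n)%N -> mean_jumps n 2 =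
  (n%:R + 1) * (10 * n%:R ^+ 3 - 6 * n%:R ^+ 2 - 25 * n%:R + 24) / 90.
Proof.
move=> n2; have := @mean_jumpsE n 2 n2 isT (orbT _).
rewrite of_Z_deval of_Z_nat mean_jumps_pow2 /=.
lra.
Qed.

Lemma mean_jumps3 n : (4 <= n)%N -> mean_jumps n 3 =
  (n%:R + 1) * (70 * n%:R ^+ 5 + 14 * n%:R ^+ 4 - 463 * n%:R ^+ 3
   + 397 * n%:R ^+ 2 + 387 * n%:R - 612) / 1890.
Proof.
move=> n4; have n2 : (2 <= n)%N by apply: leq_trans n4.
have := @mean_jumpsE n 3 n2 isT; rewrite n4 => /(_ isT).
rewrite of_Z_deval of_Z_nat mean_jumps_pow3 /=.
lra.
Qed.

Lemma mean_jumps4 n : (4 <= n)%N -> mean_jumps n 4 =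
  (n%:R + 1) * (350 * n%:R ^+ 7 + 490 * n%:R ^+ 6 - 4192 * n%:R ^+ 5
   + 1990 * n%:R ^+ 4 + 10835 * n%:R ^+ 3 - 14765 * n%:R ^+ 2
   - 5553 * n%:R + 18000) / (90 * 315).
Proof.
move=> n4; have n2 : (2 <= n)%N by apply: leq_trans n4.
have := @mean_jumpsE n 4 n2 isT; rewrite n4 => /(_ isT).
rewrite of_Z_deval of_Z_nat mean_jumps_pow4 /=.
lra.
Qed.

End Means.

(** The variance formula starts at [n = 4]: for [n = 2] the coefficient is almost surely 0, while
    the right-hand side is positive. *)
Theorem lemma2p1 (R : realType) (d : measure_display) (T : measurableType d)
    (P : probability T R) (n p : nat)
    (X : 'I_p -> {RV P >-> R}) (Xs : 'I_n -> 'I_p -> {RV P >-> R})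
    (k l : 'I_p) :
  (2 <= n)%N ->
  mutually_independent P (fun j => X j : T -> R) ->
  (forall j, continuous (cdf (X j))) ->
  iid_copies P (fun i j => Xs i j : T -> R) (fun j => X j : T -> R) ->
  k != l ->
  let xi (w : T) : R := chatterjee (fun i => Xs i k w) (fun i => Xs i l w) in
  let xi_sq (w : T) : R := xi w ^+ 2 in
  let N : R := n%:R in
  ('E_P[xi_sq] =
     ((N - 2) * (4 * N - 7) / (10 * (N - 1) ^+ 2 * (N + 1)))%:E)%E /\
  ((4 <= n)%N ->
   ('V_P[xi_sq] =
     ((224 * N ^+ 5 - 1792 * N ^+ 4 + 5051 * N ^+ 3 - 4969 * N ^+ 2
       - 2458 * N + 18128)
      / (700 * (N - 1) ^+ 4 * (N + 1) ^+ 3))%:E)%E).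
Proof.
move=> n2 X_indep X_cont X_copies kl xi xi_sq N.
have mean F := expectation_xi X_indep X_cont X_copies kl F.
have N_gt1 : 1 < N by rewrite ltr1n.
have Nm1 : N - 1 != 0 by rewrite subr_eq0 gt_eqF.
have Np1 : N + 1 != 0 by rewrite gt_eqF // addr_gt0 // (lt_trans ltr01).
have scoreE v : score R n v = 1 - 3 * v%:R / ((N - 1) * (N + 1)).
  by rewrite /score -/N (_ : N ^+ 2 - 1 = (N - 1) * (N + 1)) //; ring.
(* With this constant the coefficient is [1 - a * v], where [v] is the sum of the jumps. *)
pose a := 3 / ((N - 1) * (N + 1)).
have E_sq : ('E_P[xi_sq] =
     ((N - 2) * (4 * N - 7) / (10 * (N - 1) ^+ 2 * (N + 1)))%:E)%E.
  rewrite (mean (fun x => x ^+ 2)); congr _%:E.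
  under eq_bigr => s _.
    rewrite (_ : _ ^+ 2 = 1 + (- 2 * a) * (jumps (perm_values s))%:R
     + a ^+ 2 * (jumps (perm_values s))%:R ^+ 2
     + 0 * (jumps (perm_values s))%:R ^+ 3
     + 0 * (jumps (perm_values s))%:R ^+ 4); last first.
      rewrite scoreE /a; move: (jumps _)%:R => v; ring.
  over.
  rewrite mean_polynomial mean_jumps1 // mean_jumps2 // !mul0r !addr0 /a -/N.
  by field; rewrite Nm1 Np1.
split=> // n4.
set u := (N - 2) * (4 * N - 7) / _ in E_sq.
(* The variance unfolds to the mean of the square of [xi_sq] minus its mean [u], again a function of
   the coefficient and hence a quartic in the sum of the jumps. *)
rewrite /variance unlock E_sq /=.
rewrite (_ : (_ * _)%R = (fun x => (x ^+ 2 - u) * (x ^+ 2 - u)) \o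
  (fun w => chatterjee (fun i => Xs i k w) (fun i => Xs i l w))) // mean.
congr _%:E.
under eq_bigr => s _.
  rewrite (_ : (_ - u) * _ = (1 - u) ^+ 2 +
     (- 4 * a * (1 - u)) * (jumps (perm_values s))%:R
     + (4 * a ^+ 2 + 2 * a ^+ 2 * (1 - u)) * (jumps (perm_values s))%:R ^+ 2
     + (- 4 * a ^+ 3) * (jumps (perm_values s))%:R ^+ 3
     + a ^+ 4 * (jumps (perm_values s))%:R ^+ 4); last first.
    rewrite scoreE /a; move: (jumps _)%:R => v; ring.
over.
rewrite mean_polynomial mean_jumps1 // mean_jumps2 // mean_jumps3 //.
rewrite mean_jumps4 //.
rewrite /a /u -/N.
by field; rewrite Nm1 Np1.
Qed.
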